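(* Let $p$ be an odd prime, let $\rho: SL_2(\mathbb{F}_p)\to GL(\mathcal{H})$ be the Weil representation on $\mathcal{H}=\mathbb{C}(\mathbb{F}_p)$, let $\mathrm{w}=\begin{pmatrix}0&1\\-1&0\end{pmatrix}\in SL_2(\mathbb{F}_p)$, and let $F:\mathcal{H}\to\mathcal{H}$ be the discrete Fourier transform $F[f](y)=\frac{1}{\sqrt p}\sum_{x\in\mathbb{F}_p}e^{\frac{2\pi i}{p}yx}f(x)$. Then $$F=C\cdot\rho(\mathrm{w}),\qquad C=i^{\frac{p-1}{2}}.$$
   Context: Setting. $p$ is an odd prime, $\psi(z)=e^{2\pi i z/p}$ for $z\in\mathbb{F}_p$. $V=\mathbb{F}_p\times\mathbb{F}_p$ (column vectors $(t,w)$) carries the symplectic form $\omega((t,w),(t',w'))=tw'-wt'$. The Heisenberg group is $H=V\times\mathbb{F}_p$ with $(v,z)(v',z')=(v+v',z+z'+\tfrac12\omega(v,v'))$; $SL_2(\mathbb{F}_p)$ acts on $H$ by $g(v,z)=(gv,z)$. $\mathcal{H}=\mathbb{C}(\mathbb{F}_p)$ is the Hilbert space of complex functions on $\mathbb{F}_p$ with the standard Hermitian product. The Heisenberg representation $\pi$ of $H$ on $\mathcal{H}$ is determined by $\pi((t,0),0)[f](x)=f(x+t)$, $\pi((0,w),0)[f](x)=\psi(wx)f(x)$, $\pi(0,z)[f]=\psi(z)f$. Weil representation. $\rho:SL_2(\mathbb{F}_p)\to GL(\mathcal{H})$ is the linear representation satisfying $\rho(g)\pi(h)\rho(g)^{-1}=\pi(g(h))$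 for all $g\in SL_2(\mathbb{F}_p)$, $h\in H$. It exists, and it is unique if $p\neq3$; for $p=3$ it denotes the canonical choice, namely the one with $\mathrm{Tr}\,\rho(g)=\sigma(-\det(\kappa(g)+I))$ whenever $g-I$ is invertible, where $\kappa(g)=(g+I)(g-I)^{-1}$ and $\sigma$ is the quadratic (Legendre) character of $\mathbb{F}_p^\times$. *)

(* Defs.v *)
From HB Require Import structures.
From mathcomp Require Import all_boot all_order all_fingroup all_algebra.
From mathcomp Require Import complex ring.
From mathcomp Require Import reals trigo.

Set Implicit Arguments.
Unset Strict Implicit.
Unset Printing Implicit Defensive.

Import GRing.Theory.

Local Open Scope ring_scope.

Section Groups.
Variable p : nat.
Local Notation F := 'F_p.

(* (t, w) as a column vector. *)
Definition vec2 (t w : F) : 'cV[F]_2 := \col_i (if i == 0 then t else w).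

Definition symp (v v' : 'cV[F]_2) : F := v 0 0 * v' 1 0 - v 1 0 * v' 0 0.

Definition heis : Type := ('cV[F]_2 * F)%type.

HB.instance Definition _ := Finite.on heis.

Definition heis_mul (h h' : heis) : heis :=
  (h.1 + h'.1, h.2 + h'.2 + 2%:R^-1 * symp h.1 h'.1).
Definition heis_one : heis := (0, 0).
Definition heis_inv (h : heis) : heis := (- h.1, - h.2).

Fact heis_mulA : associative heis_mul.
Proof.
move=> [u a] [v b] [w c]; rewrite /heis_mul /symp /=; congr pair.
  by rewrite addrA.
by rewrite !mxE; ring.
Qed.

Fact heis_mul1 : left_id heis_one heis_mul.
Proof.
by move=> [u a]; rewrite /heis_mul /symp /= !mxE !mul0r subrr mulr0 addr0 !add0r.
Qed.

Fact heis_mulV : left_inverse heis_one heis_inv heis_mul.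
Proof.
move=> [u a]; rewrite /heis_mul /symp /= !mxE !addNr add0r !mulNr.
by rewrite opprK [u 0 0 * _]mulrC addNr mulr0.
Qed.

HB.instance Definition _ :=
  Finite_isGroup.Build heis heis_mulA heis_mul1 heis_mulV.

Record SL2 : predArgType := MkSL2 {
  SL2_mx :> 'M[F]_2;
  _ : \det SL2_mx == 1 }.

HB.instance Definition _ := [isSub for SL2_mx].
HB.instance Definition _ := [Finite of SL2 by <:].

Fact SL2_det (g : SL2) : \det g = 1.
Proof. exact/eqP/(valP g). Qed.

Fact SL2_mul_subproof (g g' : SL2) : \det (g *m g') == 1.
Proof. by rewrite det_mulmx !SL2_det mulr1. Qed.
Definition SL2_mul (g g' : SL2) : SL2 := MkSL2 (SL2_mul_subproof g g').

Fact SL2_one_subproof : \det (1%:M : 'M[F]_2) == 1.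
Proof. by rewrite det1. Qed.
Definition SL2_one : SL2 := MkSL2 SL2_one_subproof.

Fact SL2_inv_subproof (g : SL2) : \det (invmx g) == 1.
Proof. by rewrite det_inv SL2_det invr1. Qed.
Definition SL2_inv (g : SL2) : SL2 := MkSL2 (SL2_inv_subproof g).

Fact SL2_mulA : associative SL2_mul.
Proof. by move=> g1 g2 g3; apply: val_inj; rewrite /= mulmxA. Qed.

Fact SL2_mul1 : left_id SL2_one SL2_mul.
Proof. by move=> g; apply: val_inj; rewrite /= mul1mx. Qed.

Fact SL2_mulV : left_inverse SL2_one SL2_inv SL2_mul.
Proof.
by move=> g; apply: val_inj; rewrite /= mulVmx // unitmxE SL2_det unitr1.
Qed.

HB.instance Definition _ :=
  Finite_isGroup.Build SL2 SL2_mulA SL2_mul1 SL2_mulV.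

Definition SL2_act (g : SL2) (h : heis) : heis := (g *m h.1, h.2).

Definition weyl_mx : 'M[F]_2 :=
  \matrix_(i, j) (if i == 0 then if j == 0 then 0 else 1
                  else if j == 0 then - 1 else 0).

Fact weyl_subproof : \det weyl_mx == 1.
Proof.
rewrite (expand_det_row _ 0) !big_ord_recl big_ord0 /cofactor !det_mx11 !mxE /=.
by rewrite mul0r add0r addr0 expr1 mul1r mulrNN mulr1.
Qed.

Definition weyl : SL2 := MkSL2 weyl_subproof.

Definition cayley (g : SL2) : 'M[F]_2 :=
  (SL2_mx g + 1%:M) *m invmx (SL2_mx g - 1%:M).

End Groups.

Section Representations.
Variables (R : realType) (p : nat).
Local Notation F := 'F_p.
Local Notation C := R[i].

(* exp(2 pi i z / p), with z : 'F_p read as its representative in [0, p). *)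
Definition psi (z : F) : C :=
  let a := 2%:R * pi * (val z)%:R / p%:R in Complex (cos a) (sin a).

(* 'F_p is a fieldType for every p; its quadratic character, with value 0 at 0,
   is the Legendre symbol when p is an odd prime. *)
Definition legendre (a : F) : C :=
  if a == 0 then 0 else if [exists b : F, b ^+ 2 == a] then 1 else - 1.

Definition hilb : Type := {ffun F -> C^o}.

HB.instance Definition _ := Vector.on hilb.

Definition lfun_trace (A : 'End(hilb)) : C :=
  \sum_(x : F) A [ffun y => (y == x)%:R] x.

(* The conditions force every r g to be invertible, so that r is a
   homomorphism from G to GL(hilb). *)
Definition is_repr (G : finGroupType) (r : G -> 'End(hilb)) : Prop :=
  r 1%g = \1%VF /\ forall g h : G, r (g * h)%g = (r g \o r h)%VF.

Record heisenberg_repr (pi_ : heis p -> 'End(hilb)) : Prop := {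
  heisenberg_is_repr : is_repr pi_;
  heisenberg_shift : forall (t : F) (f : hilb) (x : F),
    pi_ (vec2 t 0, 0) f x = f (x + t);
  heisenberg_mult : forall (w : F) (f : hilb) (x : F),
    pi_ (vec2 0 w, 0) f x = psi (w * x) * f x;
  heisenberg_center : forall (z : F) (f : hilb),
    pi_ (0, z) f = psi z *: f }.

(* The trace condition selects the canonical choice when p = 3, where the
   intertwining identity leaves several representations of SL_2. *)
Record weil_repr (pi_ : heis p -> 'End(hilb)) (rho : SL2 p -> 'End(hilb)) :
  Prop := {
  weil_is_repr : is_repr rho;
  weil_intertwine : forall (g : SL2 p) (h : heis p),
    (rho g \o pi_ h \o (rho g)^-1)%VF = pi_ (SL2_act g h);
  weil_trace : p = 3%N -> forall g : SL2 p,
    SL2_mx g - 1%:M \in unitmx ->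
    lfun_trace (rho g) = legendre (- \det (cayley g + 1%:M)) }.

Definition dft (f : hilb) : hilb :=
  [ffun y : F =>
    ((Num.sqrt (p%:R : R))%:C%C)^-1 * \sum_(x : F) psi (y * x) * f x].

End Representations.

(* Main.v *)
Require Import Defs.
From mathcomp Require Import all_boot all_order all_fingroup all_algebra.
From mathcomp Require Import complex ring.
From mathcomp Require Import reals trigo.

(* The intertwining relations at h = ((0, s), 0) and ((-x, 0), 0) force
   rho(w) delta_x = c psi(x .) with c = (rho(w) delta_0)(0), so F and rho(w) are
   proportional, and d = i^((p-1)/2) c sqrt p has to be shown equal to 1.  As
   w^4 = 1 and w^2 maps delta_0 to c^2 p delta_0, we have d^4 = 1, so it is
   enough that some odd power of d is nonnegative.
   For p > 3 every character of SL_2(F_p) is trivial on w, so det rho(w) = 1,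
   while det (psi(xy)) is a Vandermonde determinant equal to i^(p(p-1)/2) times
   a positive real; hence d^p >= 0.  For p = 3 the trace condition gives
   c (1 + 2 psi(1)) = 1 with 1 + 2 psi(1) = 2 i sin(pi/3), hence d >= 0. *)

Set Implicit Arguments.
Unset Strict Implicit.
Unset Printing Implicit Defensive.

Import Order.TTheory GRing.Theory Num.Theory.

Local Open Scope ring_scope.

(** * Sums over pairs of indices *)

Lemma sum_ltn_pairs n :
  (\sum_(i < n) \sum_(j < n | i < j) (i + j) = n.-1 * 'C(n, 2))%N.
Proof.
(* Splitting i + j and exchanging the order of summation in the j half collects each index once for
   every other index, hence n - 1 times. *)
have -> : (\sum_(i < n) \sum_(j < n | i < j) (i + j) =
           \sum_(i < n) \sum_(j < n | i < j) i +
           \sum_(i < n) \sum_(j < n | j < i) i)%N.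
  rewrite [X in (_ = _ + X)%N](exchange_big_dep xpredT) //= -big_split /=.
  by apply: eq_bigr => i _; rewrite -big_split.
rewrite -big_split /= -bin2_sum big_mkord big_distrr /=.
apply: eq_bigr => i _.
transitivity (\sum_(j < n | j != i) i)%N.
  rewrite [RHS](bigID (fun j : 'I_n => i < j)%N) /=.
  congr addn; apply: eq_bigl => j.
    by rewrite andbC -val_eqE /=; case: ltngtP.
  by rewrite -leqNgt -val_eqE /=; case: ltngtP.
by rewrite sum_nat_const; congr muln; rewrite cardC1 card_ord.
Qed.

Lemma card_ltn_pairs n : (\sum_(i < n) \sum_(j < n | i < j) 1 = 'C(n, 2))%N.
Proof.
rewrite (exchange_big_dep xpredT) //= -bin2_sum big_mkord.
apply: eq_bigr => i _.
by rewrite -(big_ord_widen n (fun=> 1%N) (ltnW (ltn_ord i))) sum1_card card_ord.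
Qed.

(** * Points of the unit circle *)

Section Cis.
Variable R : realType.
Implicit Type a : R.

Definition cis a : R[i] := Complex (cos a) (sin a).

Lemma cis0 : cis 0 = 1.
Proof. by rewrite /cis cos0 sin0. Qed.

Lemma cisD a b : cis (a + b) = cis a * cis b.
Proof.
apply/eqP; rewrite eq_complex /= cosD sinD.
by apply/andP; split; apply/eqP; ring.
Qed.

Lemma cisMn a n : cis (a *+ n) = cis a ^+ n.
Proof.
by elim: n => [|n IHn]; rewrite ?mulr0n ?cis0 // mulrS exprS cisD IHn.
Qed.

Lemma cis2pi : cis (pi *+ 2) = 1.
Proof. by rewrite /cis cos2pi sin2pi. Qed.

(** Factoring out the midpoint [cis (a + b)] leaves a difference of two conjugate points, which is
    purely imaginary. *)
Lemma cis_double_sub a b :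
  cis (b *+ 2) - cis (a *+ 2) = cis (a + b) * 'i%C * (2 * sin (b - a))%:C%C.
Proof.
have -> : cis (b *+ 2) = cis (a + b) * cis (b - a).
  by rewrite -cisD; congr cis; ring.
have -> : cis (a *+ 2) = cis (a + b) * cis (- (b - a)).
  by rewrite -cisD; congr cis; ring.
rewrite -mulrBr -mulrA; congr (_ * _).
apply/eqP; rewrite eq_complex /= cosN sinN.
by apply/andP; split; apply/eqP; ring.
Qed.

End Cis.

(** * The additive character of F_p and the determinant of its matrix *)

Section Psi.
Variables (R : realType) (p : nat).
Hypothesis p_prime : prime p.
Hypothesis p_odd : odd p.
Local Notation psi := (@psi R p).
Local Notation q := (Zp_trunc (pdiv p)).+2.
Local Notation theta := (pi / p%:R : R).

Let p_gt0 : (0 < p)%N := prime_gt0 p_prime.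
Let p_neq0 : p%:R != 0 :> R.
Proof. by rewrite pnatr_eq0 -lt0n. Qed.

Lemma psiE z : psi z = cis (theta *+ 2) ^+ z.
Proof.
by rewrite -cisMn /psi /cis -mulr_natr; congr Complex; congr (_ _); field.
Qed.

Lemma cis_theta_order : cis (theta *+ 2) ^+ p = 1.
Proof.
rewrite -cisMn -cis2pi; congr cis.
by rewrite mulrnAC -[theta *+ p]mulr_natr divfK.
Qed.

Lemma psi_nat n : psi n%:R = cis (theta *+ 2) ^+ n.
Proof.
rewrite psiE val_Fp_nat // [in RHS](divn_eq n p) exprD mulnC exprM.
by rewrite cis_theta_order !expr1n mul1r.
Qed.

Lemma psi0 : psi 0 = 1.
Proof. by rewrite psiE expr0. Qed.

Lemma psiD x y : psi (x + y) = psi x * psi y.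
Proof.
by rewrite -[x in LHS]natr_Zp -[y in LHS]natr_Zp -natrD psi_nat exprD !psiE.
Qed.

Lemma sin_theta_gt0 n : (0 < n < p)%N -> 0 < sin (theta *+ n).
Proof.
case/andP=> n_gt0 n_lt; apply: sin_gt0_pi.
rewrite pmulrn_lgt0 // divr_gt0 ?pi_gt0 ?ltr0n //=.
rewrite -[_ *+ n]mulr_natr -mulrA gtr_pMr ?pi_gt0 //.
by rewrite mulrC ltr_pdivrMr ?ltr0n // mul1r ltr_nat.
Qed.

Lemma cis_thetaB (i j : nat) :
  cis (theta *+ 2) ^+ j - cis (theta *+ 2) ^+ i =
    cis theta ^+ (i + j) * 'i%C * (2 * sin (theta *+ j - theta *+ i))%:C%C.
Proof. by rewrite -!cisMn ![_ *+ 2 *+ _]mulrnAC cis_double_sub mulrnDr. Qed.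

(** The difference [psi x - psi 0] factors by [cis_thetaB], and sin(pi x / p) > 0 because the
    representative of x lies strictly between 0 and p. *)
Lemma psi_neq1 x : x != 0 -> psi x != 1.
Proof.
move=> x_neq0; rewrite -psi0 -subr_eq0 !psiE cis_thetaB mulr0n subr0.
have x_gt0 : 0 < sin (theta *+ x).
  apply: sin_theta_gt0; rewrite lt0n x_neq0.
  by rewrite -[X in (_ < X)%N](Fp_cast p_prime) ltn_ord.
rewrite !mulf_neq0 //.
- rewrite expf_eq0; apply/nandP; right; apply/eqP=> [[c0 s0]].
  have /eqP := cos2Dsin2 theta.
  by rewrite c0 s0 !expr0n addr0 eq_sym oner_eq0.
- by rewrite eq_complex /= oner_eq0 andbF.
- by rewrite eq_complex /= !mulf_eq0 pnatr_eq0 (gt_eqF x_gt0).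
Qed.

Lemma psi_sum x : \sum_y psi (x * y) = if x == 0 then p%:R else 0.
Proof.
case: eqP => [-> | /eqP x_neq0].
  under eq_bigr do rewrite mul0r psi0.
  by rewrite sumr_const card_Fp.
(* Translating y by 1 multiplies the sum by [psi x], which differs from 1, so the sum vanishes. *)
apply: (mulfI (_ : psi x - 1 != 0)); first by rewrite subr_eq0 psi_neq1.
rewrite mulr0 mulrBl mul1r big_distrr /= [X in _ - X](reindex_inj (addrI 1)) /=.
apply/eqP; rewrite subr_eq0; apply/eqP/eq_bigr => y _.
by rewrite mulrDr mulr1 psiD.
Qed.

(** The size is [q], convertible to the bound of the ordinal type ['F_p], so that field elements
    serve directly as indices; [Fp_cast] identifies it with p. *)
Definition psi_mx : 'M[R[i]]_q := \matrix_(x, y) psi (x * y).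

(* With e = exp(i pi / p) each Vandermonde factor is
   e^(2k) - e^(2j) = e^(j+k) i (2 sin(pi (k-j) / p)); the e^(j+k) multiply to 1
   and the factors i, one per pair, to i^(p(p-1)/2). *)
Lemma det_psi_mx :
  exists2 a : R, 0 < a & \det psi_mx = ('i%C ^+ ((p - 1) %/ 2)) ^+ p * a%:C%C.
Proof.
have -> : psi_mx = Vandermonde _ (\row_y psi y).
  apply/matrixP=> x y; rewrite !mxE.
  rewrite -[x in LHS]natr_Zp -[y in LHS]natr_Zp -natrM.
  by rewrite psi_nat psiE -exprM mulnC.
rewrite det_Vandermonde.
exists (\prod_(i < p) \prod_(j < p | (i < j)%N)
          (2 * sin (theta *+ j - theta *+ i))).
  apply: prodr_gt0 => i _; apply: prodr_gt0 => j lt_ij.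
  rewrite mulr_gt0 ?ltr0n // -mulrnBr ?(ltnW lt_ij) // sin_theta_gt0 //.
  by rewrite subn_gt0 lt_ij (leq_ltn_trans (leq_subr _ _)).
transitivity (\prod_(i < q) \prod_(j < q | (i < j)%N)
                (cis (theta *+ 2) ^+ j - cis (theta *+ 2) ^+ i)).
  by apply: eq_bigr => i _; apply: eq_bigr => j _; rewrite !mxE !psiE.
rewrite (Fp_cast p_prime).
transitivity (\prod_(i < p) (cis theta ^+ (\sum_(j < p | (i < j)%N) (i + j)) *
    'i%C ^+ (\sum_(j < p | (i < j)%N) 1) *
    (\prod_(j < p | (i < j)%N) (2 * sin (theta *+ j - theta *+ i)))%:C%C)).
  apply: eq_bigr => i _; rewrite !expr_sum rmorph_prod -!big_split /=.
  by apply: eq_bigr => j _; rewrite cis_thetaB expr1.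
rewrite !big_split /= -!expr_sum -rmorph_prod /=; congr (_ * _).
rewrite sum_ltn_pairs card_ltn_pairs.
have [m p_eq] : exists m, p = m.*2.+1.
  by exists p./2; rewrite -[LHS]odd_double_half p_odd.
have -> : 'C(p, 2) = (m * p)%N by rewrite bin2 p_eq /= -doubleMr doubleK mulnC.
have -> : ((p - 1) %/ 2 = m)%N by rewrite p_eq subn1 /= -muln2 mulnK.
(* With p = 2m + 1 the total exponent of [cis theta] is a multiple of 2p, and [cis theta] is a 2p-th
   root of unity. *)
have -> : (p.-1 * (m * p) = 2 * p * (m * m))%N by rewrite p_eq /= -muln2; ring.
by rewrite !exprM -cisMn cis_theta_order !expr1n mul1r.
Qed.

End Psi.

(** A nonnegative fourth root of unity is 1, so [d ^+ n = 1]; since n is prime to 4, this and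
    [d ^+ 4 = 1] leave only d = 1. *)
Lemma eq1_expr4_odd (K : numDomainType) (d : K) n :
  odd n -> d ^+ 4 = 1 -> 0 <= d ^+ n -> d = 1.
Proof.
move=> n_odd d4 dn_ge0.
have dn : d ^+ n = 1.
  by apply/eqP; rewrite -(@pexpr_eq1 _ _ 4) // exprAC d4 expr1n.
have : odd (n %% 4) by rewrite -[odd _]/(odd (n %% (2 * 2))) odd_mod.
have : d ^+ (n %% 4) = 1 by rewrite expr_mod.
have := ltn_pmod n (isT : (0 < 4)%N).
case: (n %% 4)%N => [|[|[|[|//]]]] // _.
by move=> d3; rewrite exprS d3 mulr1 in d4.
Qed.

(** * Characters of SL_2(F_p), and the Cayley transform of w *)

Section SL2Characters.
Variable p : nat.
Hypothesis p_prime : prime p.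
Local Notation F := 'F_p.

Lemma natF_neq0 n : (0 < n < p)%N -> n%:R != 0 :> F.
Proof.
case/andP=> n_gt0 n_lt.
by rewrite -val_eqE /= val_Fp_nat // modn_small // -lt0n.
Qed.

(** The nested conditionals copy those of [weyl_mx], so that [weyl_mxE] holds by conversion. *)
Definition mx2 (a b c d : F) : 'M[F]_2 :=
  \matrix_(i, j) (if i == 0 then if j == 0 then a else b
                  else if j == 0 then c else d).

Lemma det_mx2 a b c d : \det (mx2 a b c d) = a * d - b * c.
Proof.
rewrite (expand_det_row _ 0) !big_ord_recl big_ord0 /cofactor !det_mx11 !mxE /=.
by rewrite addr0 mul1r expr1 mulN1r mulrN.
Qed.

Lemma mul_mx2 a b c d a' b' c' d' :
  mx2 a b c d *m mx2 a' b' c' d' =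
    mx2 (a * a' + b * c') (a * b' + b * d') (c * a' + d * c') (c * b' + d * d').
Proof.
apply/matrixP=> i j; rewrite !mxE !big_ord_recl big_ord0 !mxE /= addr0.
by case: ifP; case: ifP.
Qed.

Lemma mx2_1 : 1%:M = mx2 1 0 0 1.
Proof.
apply/matrixP=> i j; rewrite !mxE.
by case: i => [[|[|//]] ?]; case: j => [[|[|//]] ?].
Qed.

Fact upper_subproof (b : F) : \det (mx2 1 b 0 1) == 1.
Proof. by rewrite det_mx2 mulr1 mulr0 subr0. Qed.
Definition upper b : SL2 p := MkSL2 (upper_subproof b).

Fact lower_subproof (c : F) : \det (mx2 1 0 c 1) == 1.
Proof. by rewrite det_mx2 mulr1 mul0r subr0. Qed.
Definition lower c : SL2 p := MkSL2 (lower_subproof c).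

Lemma weyl_mxE : weyl_mx p = mx2 0 1 (- 1) 0.
Proof. by []. Qed.

(* In group_scope 1 would be the neutral element 0 of the additive group 'F_p. *)
Lemma weylE : weyl p = (upper 1%R * lower (- 1)%R * upper 1%R)%g.
Proof. by apply: val_inj; rewrite /= weyl_mxE !mul_mx2; congr mx2; ring. Qed.

Lemma weyl4 : (weyl p * weyl p * (weyl p * weyl p))%g = 1%g.
Proof.
by apply: val_inj; rewrite /= weyl_mxE !mul_mx2 mx2_1; congr mx2; ring.
Qed.

(* diag(2, 1/2) conjugates upper b into upper (4 b), so the character is
   trivial on upper (3 b); dually for lower. *)
Lemma char_weyl (K : fieldType) (chi : SL2 p -> K) :
  (3 < p)%N -> chi 1%g = 1 -> {morph chi : g h / (g * h)%g >-> g * h} ->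
  chi (weyl p) = 1.
Proof.
move=> p_gt3 chi1 chiM.
have nz2 : 2%:R != 0 :> F by exact: (@natF_neq0 2%N (ltnW p_gt3)).
have nz3 : 3%:R != 0 :> F by exact: (@natF_neq0 3%N p_gt3).
have chi_neq0 g : chi g != 0.
  apply/eqP=> chi_g; move/eqP: chi1.
  by rewrite -(mulgV g) chiM chi_g mul0r eq_sym oner_eq0.
have diag_subproof : \det (mx2 2 0 0 2^-1) == 1.
  by rewrite det_mx2 mulfV // mul0r subr0.
pose t : SL2 p := MkSL2 diag_subproof.
have chi_upper b : chi (upper b) = 1.
  have : (t * upper (b / 3)%R = upper b * upper (b / 3)%R * t)%g.
    by apply: val_inj; rewrite /= !mul_mx2; congr mx2; field; rewrite ?nz2 ?nz3.
  move/(congr1 chi); rewrite !chiM mulrC => /(mulIf (chi_neq0 _)) eq_chi.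
  by apply: (mulIf (chi_neq0 (upper (b / 3)))); rewrite mul1r.
have chi_lower c : chi (lower c) = 1.
  have : (lower (c / 3)%R * t = t * (lower c * lower (c / 3)%R))%g.
    by apply: val_inj; rewrite /= !mul_mx2; congr mx2; field; rewrite ?nz2 ?nz3.
  move/(congr1 chi); rewrite !chiM mulrC => /(mulfI (chi_neq0 _)) eq_chi.
  by apply: (mulIf (chi_neq0 (lower (c / 3)))); rewrite mul1r.
by rewrite weylE !chiM !chi_upper chi_lower !mulr1.
Qed.

Lemma det_weyl_sub1 : \det (SL2_mx (weyl p) - 1%:M) = 2.
Proof.
rewrite (expand_det_row _ 0) !big_ord_recl big_ord0 /cofactor !det_mx11 !mxE /=.
ring.
Qed.

(** Multiplying [cayley g + 1] by g - 1 gives (g + 1) + (g - 1) = 2g, whose determinant is 4. *)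
Lemma det_cayleyD1 (g : SL2 p) : SL2_mx g - 1%:M \in unitmx ->
  \det (cayley g + 1%:M) * \det (SL2_mx g - 1%:M) = 4.
Proof.
move=> unit_g; rewrite -det_mulmx mulmxDl mulmxKV // mul1mx addrCA addrK.
have -> : SL2_mx g + SL2_mx g = 2 *: SL2_mx g by rewrite scaler_nat mulr2n.
by rewrite detZ SL2_det mulr1 -natrX.
Qed.

Lemma legendre1 (R : realType) : legendre R (1 : F) = 1.
Proof.
rewrite /legendre oner_eq0; case: existsP => // [[]].
by exists 1; rewrite expr1n.
Qed.

(** Since det(w - 1) = 2, the Cayley determinant is 4 / 2 = 2, and -2 = 1 is a square in F_3. *)
Lemma legendre_cayley_weyl3 (R : realType) :
  p = 3%N -> legendre R (- \det (cayley (weyl p) + 1%:M)) = 1.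
Proof.
move=> p3; have nz2 : 2%:R != 0 :> F by rewrite natF_neq0 ?p3.
have := det_cayleyD1 (g := weyl p).
rewrite unitmxE det_weyl_sub1 unitfE => /(_ nz2).
rewrite (natrM _ 2%N 2%N) => /(mulIf nz2) ->.
suff -> : - 2 = 1 :> F by exact: legendre1.
have : 3%:R = 0 :> F by rewrite -{1}p3 pchar_Fp_0.
by rewrite (natrD _ 1%N 2%N) => /eqP; rewrite addr_eq0 => /eqP <-.
Qed.

End SL2Characters.

(** The squares modulo 3 are 0, 1, 1, so the sum is 1 + 2z with z = psi(1). As 1 + z + z^2 = 0, this
    equals z - z^2, which [cis_thetaB] evaluates using e^(i pi) = -1. *)
Lemma psi_sq_sum3 (R : realType) p : p = 3%N ->
  \sum_(x : 'F_p) psi R (x * x) = 'i%C * (2 * sin (pi / 3%:R))%:C%C.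
Proof.
move=> ->; have := psi_sum R (isT : prime 3) 1.
rewrite oner_eq0 !big_ord_recl !big_ord0 !(psiE _ (isT : prime 3)) /= !addr0.
rewrite !expr1 => sum0.
set z := cis _ in sum0 *.
have {}sum0 : 1 + (z + z ^+ 2) = 0 := sum0.
have := cis_thetaB R 3 1 2; rewrite -/z expr1 -mulrnBr // mulr1n.
have -> : cis (pi / 3%:R : R) ^+ (1 + 2) = - 1.
  rewrite -cisMn -[_ *+ _]mulr_natr divfK ?pnatr_eq0 //.
  by rewrite /cis cospi sinpi -[RHS]/(Complex (- 1) (- 0)) oppr0.
rewrite -mulrA mulN1r => diff_z.
transitivity (z - z ^+ 2); last by rewrite -opprB diff_z opprK.
rewrite -[LHS]/(1 + (z + z)); apply/eqP; rewrite -subr_eq0 -sum0; apply/eqP.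
ring.
Qed.

(** * The Weil operator of w in the basis of delta functions *)

Section Weil.
Variables (R : realType) (p : nat).
Hypothesis p_prime : prime p.
Local Notation F := 'F_p.
Local Notation H := (hilb R p).
Local Notation q := (Zp_trunc (pdiv p)).+2.

Definition delta (x : F) : H := [ffun y => (y == x)%:R].

Lemma sum_hilbE (I : Type) (r : seq I) (f : I -> H) y :
  (\sum_(i <- r) f i) y = \sum_(i <- r) f i y.
Proof. by apply: (big_morph (fun g : H => g y)) => [g h|]; rewrite ffunE. Qed.

Lemma scale_hilbE (a : R[i]) (f : H) y : (a *: f) y = a * f y.
Proof. by rewrite ffunE. Qed.

Lemma hilb_sum_delta (f : H) : f = \sum_x (f x : R[i]) *: delta x.
Proof.
apply/ffunP=> y; rewrite sum_hilbE.
transitivity (\sum_x (f x * (y == x)%:R) : R[i]).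
  rewrite (bigD1 y) //= eqxx mulr1 big1 ?addr0 // => x x_neq.
  by rewrite eq_sym (negPf x_neq) mulr0.
by apply: eq_bigr => x _; rewrite scale_hilbE ffunE.
Qed.

Lemma lfun_deltaE (A : 'End(H)) f y : A f y = \sum_x f x * A (delta x) y.
Proof.
rewrite [in LHS](hilb_sum_delta f) linear_sum sum_hilbE; apply: eq_bigr => x _.
by rewrite linearZ !ffunE.
Qed.

(** Images of the [delta x] are stored as rows, so composition reverses products; determinants are
    unaffected. *)
Definition lfun_mx (A : 'End(H)) : 'M[R[i]]_q :=
  \matrix_(x, y) A (delta x) y.

Lemma lfun_mx_id : lfun_mx \1%VF = 1%:M.
Proof. by apply/matrixP=> x y; rewrite !mxE lfunE ffunE eq_sym. Qed.

Lemma lfun_mx_comp A B : lfun_mx (A \o B)%VF = lfun_mx B *m lfun_mx A.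
Proof.
apply/matrixP=> x y; rewrite !mxE lfunE /= lfun_deltaE.
by apply: eq_bigr => z _; rewrite !mxE.
Qed.

(** The inverse in [weil_intertwine] is a total operation on endomorphisms; a zero kernel is what
    lets it cancel [rho g]. *)
Lemma repr_lker0 (G : finGroupType) (r : G -> 'End(H)) g :
  is_repr r -> lker (r g) == 0%VS.
Proof.
case=> r1 rM; apply/lker0P=> f f' eq_rg.
have rVK f0 : r g^-1%g (r g f0) = f0.
  by rewrite -[LHS]comp_lfunE -rM mulVg r1 lfunE.
by rewrite -[f]rVK eq_rg rVK.
Qed.

Variables (pi_ : heis p -> 'End(H)) (rho : SL2 p -> 'End(H)).
Hypothesis pi_repr : heisenberg_repr pi_.
Hypothesis rho_weil : weil_repr pi_ rho.

Lemma weil_commute g h f : rho g (pi_ h f) = pi_ (SL2_act g h) (rho g f).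
Proof.
rewrite -(weil_intertwine rho_weil) !comp_lfunE lker0_lfunK //.
exact: (repr_lker0 _ (weil_is_repr rho_weil)).
Qed.

Lemma weyl_act (t w : F) : SL2_act (weyl p) (vec2 t w, 0) = (vec2 w (- t), 0).
Proof.
congr pair; apply/matrixP=> i j.
rewrite !mxE !big_ord_recl big_ord0 !mxE /= addr0.
by case: ifP => _; rewrite mul0r ?mul1r ?mulN1r ?add0r ?addr0.
Qed.

(** Multiplication operators fix [delta 0] and w turns them into shifts, so the image of [delta 0]
    is constant. [delta x] is a shift of [delta 0], and w turns that shift into multiplication by
    psi(x y). *)
Lemma weil_weyl_delta x y :
  rho (weyl p) (delta x) y = rho (weyl p) (delta 0) 0 * psi R (x * y).
Proof.
have shift_delta : delta x = pi_ (vec2 (- x) 0, 0) (delta 0).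
  by apply/ffunP=> z; rewrite (heisenberg_shift pi_repr) !ffunE subr_eq0.
have mult_delta : delta 0 = pi_ (vec2 0 y, 0) (delta 0).
  apply/ffunP=> z; rewrite (heisenberg_mult pi_repr) !ffunE.
  by case: eqP => [->|_]; rewrite mulr0 // psi0 // mul1r.
rewrite shift_delta weil_commute weyl_act opprK (heisenberg_mult pi_repr) mulrC.
congr (_ * _); rewrite {2}mult_delta weil_commute weyl_act oppr0.
by rewrite (heisenberg_shift pi_repr) add0r.
Qed.

Definition weyl_coeff : R[i] := rho (weyl p) (delta 0) 0.

Lemma weil_weylE f y :
  rho (weyl p) f y = weyl_coeff * \sum_x psi R (y * x) * f x.
Proof.
rewrite lfun_deltaE big_distrr; apply: eq_bigr => x _ /=.
by rewrite weil_weyl_delta mulrCA [y * x]mulrC [f x * _]mulrC.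
Qed.

Lemma weyl_coeff_sqr : (weyl_coeff ^+ 2 * p%:R) ^+ 2 = 1.
Proof.
have [rho1 rhoM] := weil_is_repr rho_weil.
set w := weyl p; set k := _ * _.
have rho2 : rho w (rho w (delta 0)) = (k : R[i]) *: delta 0.
  apply/ffunP=> y; rewrite weil_weylE !ffunE.
  (* The first application of [rho w] gives a constant function, so the second is a full character
     sum, concentrated at 0. *)
  under eq_bigr do rewrite weil_weyl_delta mul0r psi0 // mulr1.
  rewrite -big_distrl /= psi_sum // /k /GRing.scale /= -/weyl_coeff.
  by case: eqP => _; rewrite ?mul0r ?mulr0 // mulr1; ring.
have : rho (w * w * (w * w))%g (delta 0) = delta 0 by rewrite weyl4 rho1 lfunE.
rewrite !rhoM !comp_lfunE rho2 !linearZ /= rho2 scalerA -expr2.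
by move/ffunP/(_ 0); rewrite !ffunE eqxx [LHS]mulr1.
Qed.

(** * Determination of the constant *)

Hypothesis p_odd : odd p.
Local Notation phase := (('i%C : R[i]) ^+ ((p - 1) %/ 2)).
Local Notation d := (phase * weyl_coeff * (Num.sqrt (p%:R : R))%:C%C).

Lemma sqrt_natC_sqr : ((Num.sqrt (p%:R : R))%:C%C) ^+ 2 = p%:R :> R[i].
Proof. by rewrite -rmorphXn /= sqr_sqrtr ?ler0n // rmorph_nat. Qed.

Lemma normalized_coeff_expr4 : d ^+ 4 = 1.
Proof.
rewrite !exprMn [phase ^+ 4]exprAC -[4%N]/(2 * 2)%N !exprM sqr_i sqrrN !expr1n.
by rewrite mul1r -exprMn sqrt_natC_sqr weyl_coeff_sqr.
Qed.

Lemma normalized_coeff_expr_p : (3 < p)%N -> 0 <= d ^+ p.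
Proof.
move=> p_gt3; have [rho1 rhoM] := weil_is_repr rho_weil.
have : \det (lfun_mx (rho (weyl p))) = 1.
  apply: (char_weyl p_prime (chi := fun g => \det (lfun_mx (rho g)))) => //.
    by rewrite rho1 lfun_mx_id det1.
  by move=> g h; rewrite rhoM lfun_mx_comp det_mulmx mulrC.
have -> : lfun_mx (rho (weyl p)) = weyl_coeff *: psi_mx R p.
  by apply/matrixP=> x y; rewrite !mxE weil_weyl_delta.
have [a a_gt0 det_psi] := det_psi_mx R p_prime p_odd.
rewrite detZ det_psi Fp_cast //.
have aC_gt0 : 0 < a%:C%C by rewrite ltcR.
(* The determinant identity becomes (phase * c)^p * a = 1, so (phase * c)^p is the inverse of a
   positive real. *)
rewrite mulrCA mulrA -exprMn => /(canRL (mulfK (lt0r_neq0 aC_gt0))) coeff_p.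
rewrite exprMn coeff_p mul1r.
apply: mulr_ge0; last by rewrite exprn_ge0 // ler0c sqrtr_ge0.
by rewrite invr_ge0 ltW.
Qed.

Lemma normalized_coeff_3 : p = 3%N -> 0 <= d.
Proof.
move=> p3; have := weil_trace rho_weil p3 (g := weyl p).
rewrite unitmxE det_weyl_sub1 unitfE natF_neq0 ?p3 // => /(_ isT).
rewrite legendre_cayley_weyl3 //.
(* The trace is c times a quadratic Gauss sum, whose factor i is exactly the phase for p = 3. *)
have -> : lfun_trace (rho (weyl p)) = weyl_coeff * \sum_(x : F) psi R (x * x).
  by rewrite big_distrr; apply: eq_bigr => x _; rewrite /= -weil_weyl_delta.
rewrite psi_sq_sum3 //.
have s_gt0 : 0 < (2 * sin (pi / 3%:R : R))%:C%C.
  by rewrite ltcR mulr_gt0 ?ltr0n // -[_ / _]mulr1n sin_theta_gt0.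
rewrite mulrA => /(canRL (mulfK (lt0r_neq0 s_gt0))) coeff_i.
rewrite p3 expr1 [_ * weyl_coeff]mulrC coeff_i mul1r.
apply: mulr_ge0; last by rewrite ler0c sqrtr_ge0.
by rewrite invr_ge0 ltW.
Qed.

End Weil.

Theorem theorem4 (R : realType) (p : nat) (p_prime : prime p) (p_odd : odd p)
    (pi_ : heis p -> 'End(hilb R p)) (pi_repr : heisenberg_repr pi_)
    (rho : SL2 p -> 'End(hilb R p)) (rho_weil : weil_repr pi_ rho) :
  forall f : hilb R p,
    dft f = ('i%C : R[i]) ^+ ((p - 1) %/ 2)%N *: rho (weyl p) f.
Proof.
move=> f; apply/ffunP=> y; rewrite ffunE scale_hilbE.
rewrite (weil_weylE p_prime pi_repr rho_weil) mulrA; congr (_ * _).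
(* What remains is 1 / sqrt p = i^((p-1)/2) c, that is, [d = 1]. *)
pose d : R[i] :=
  'i%C ^+ ((p - 1) %/ 2) * weyl_coeff rho * (Num.sqrt (p%:R : R))%:C%C.
have d4 : d ^+ 4 = 1 := normalized_coeff_expr4 p_prime pi_repr rho_weil.
have d1 : d = 1.
  have [p_gt3 | p_le3] := ltnP 3 p.
    apply: (eq1_expr4_odd p_odd) => //.
    exact: (normalized_coeff_expr_p p_prime pi_repr rho_weil p_odd p_gt3).
  have p3 : p = 3%N by move: p_prime p_odd p_le3; case: (p) => [|[|[|[|]]]].
  apply: (@eq1_expr4_odd _ _ 1) => //; rewrite expr1.
  exact: (normalized_coeff_3 p_prime pi_repr rho_weil p3).
have s_neq0 : (Num.sqrt (p%:R : R))%:C%C != 0.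
  by rewrite lt0r_neq0 // ltcR sqrtr_gt0 ltr0n prime_gt0.
by apply: (mulIf s_neq0); rewrite mulVf.
Qed.
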